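(* Assume that (A1) the Markov chain $(Z(t))$ is irreducible on $E\subset\mathbb{Z}^d$, and (A3') $0\in E$ and for any $u\in E$: $E+u\subset E$ and $p(x+u,y+u)\ge p(x,y)$ for all $x,y\in E$. Let $h:E\to\mathbb{R}_+$ be a harmonic function for $(Z(t))$ such that $$h(z+u)\ge h(z)\qquad\text{for all } z,u\in E.$$ Then the following assertions hold. (1) If $\mathbb{E}_\cdot(\tau)=+\infty$, then $h$ is proportional to $V$ and for any $x\in E$, $$h(x)=h(0)V(x)=h(0)\lim_{n\to\infty}\frac{\mathbb{P}_x(\tau>n)}{\mathbb{P}_0(\tau>n)} .$$ (2) If $\mathbb{E}_\cdot(\tau)<+\infty$ and $h$ is not identically zero, then $h\ge h(0)V$ and the function $h-h(0)V$ is non-trivial (not identically zero).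
   Context: $(Z(t))_{t\in\mathbb{N}}$ is a transient sub-stochastic time-homogeneous Markov chain on a countable set $E\subset\mathbb{Z}^d$ with transition probabilities $p(x,y)$, $x,y\in E$ ($\sum_{y\in E}p(x,y)\le 1$), completed by an absorbing state $\vartheta$ with $p(x,\vartheta)=1-\sum_{y\in E}p(x,y)$, $p(\vartheta,\vartheta)=1$. $\mathbb{P}_x,\mathbb{E}_x$ refer to the initial state $x$. A function $h:E\to\mathbb{R}_+$ is harmonic for $(Z(t))$ if $\sum_{y\in E}p(x,y)h(y)=h(x)$ for all $x\in E$. $G(x,y)=\sum_{n\ge0}\mathbb{P}_x(Z(n)=y)$ is the Green function. $\tau=\inf\{t\ge1: Z(t)=\vartheta\}$ is the exit time from $E$; by irreducibility $x\mapsto\mathbb{E}_x(\tau)$ is either finite everywhere on $E$ (written $\mathbb{E}_\cdot(\tau)<+\infty$) or infinite everywhere on $E$ (written $\mathbb{E}_\cdot(\tau)=+\infty$). Ladder height process and renewal function: for $u,x,y\in E$ let $$a_u(x,y)=\begin{cases}p(x+u,y)-p(x,y-u)&\text{if }y\in E+u,\\ p(x+u,y)&\text{otherwise,}\end{cases}$$ which is non-negative by (A3'), and $p_H(x,y)=\sum_{z\in E}G(0,z)\,a_x(z,y)$, $x,y\in E$. It is known that under (A1) and (A3') the matrix $(p_H(x,y))_{x,y\in E}$ is sub-stochastic; put $p_H(x,\vartheta)=1-\sum_{y\in E}p_H(x,y)$, $p_H(\vartheta,\vartheta)=1$. The ladder height process $(H(n))$ is the Markov chain on $E\cup\{\vartheta\}$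 with transition probabilities $p_H$. With $\mathcal{T}=\inf\{n>0: H(n)=\vartheta\}$, the renewal function is $V(x)=\mathbb{E}_x(\mathcal{T})$ (for $H(0)=x$), $x\in E$, and $V(\vartheta)=0$. It is known that under (A1) and (A3') $V$ is finite with $V(0)=1$. *)

(* Defs.v *)
From mathcomp Require Import all_boot all_order all_algebra.
From mathcomp Require Import all_classical all_reals all_analysis.
Set Implicit Arguments.
Unset Strict Implicit.
Unset Printing Implicit Defensive.
Import Order.TTheory GRing.Theory Num.Theory.
Import numFieldNormedType.Exports.
Local Open Scope classical_set_scope.
Local Open Scope ring_scope.

Notation lattice d := 'rV[int]_d.

Section MarkovChains.
Variable R : realType.
Local Open Scope ereal_scope.

(* [X] is, under [P], a time-homogeneous Markov chain on the countable set [S]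
   with transition kernel [k] and initial state [x0].  The last clause is the
   division-free form of
   P(X_{n+1} = s_{n+1} | X_0 = s_0, ..., X_n = s_n) = k s_n s_{n+1}. *)
Definition markov_chain (dO : measure_display) (Omega : measurableType dO)
    (T : Type) (S : set T) (k : T -> T -> \bar R) (x0 : T)
    (P : probability Omega R) (X : nat -> Omega -> T) : Prop :=
  [/\ forall n w, S (X n w),
      forall n s, measurable [set w | X n w = s],
      P [set w | X 0%N w = x0] = 1 &
      forall n (s : nat -> T), (forall i, S (s i)) ->
        P [set w | forall i, (i <= n.+1)%N -> X i w = s i] =
        P [set w | forall i, (i <= n)%N -> X i w = s i] * k (s n) (s n.+1)].

(* The absorbing state is [None]. *)
Definition with_cemetery (T : Type) (E : set T) : set (option T) :=
  [set s | if s is Some x then E x else True].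

Definition completed_kernel (T : choiceType) (E : set T) (k : T -> T -> \bar R)
    (s t : option T) : \bar R :=
  match s, t with
  | Some x, Some y => k x y
  | Some x, None => 1 - \esum_(y in E) k x y
  | None, Some _ => 0
  | None, None => 1
  end.

(* [+oo] when [None] is never hit at a time [t >= 1] ([ereal_inf set0 = +oo]). *)
Definition exit_time (Omega T : Type) (X : nat -> Omega -> option T) (w : Omega)
    : \bar R :=
  ereal_inf [set t%:R%:E | t in [set t : nat | (1 <= t)%N /\ X t w = None]].

Definition mean_exit_time (dO : measure_display) (Omega : measurableType dO)
    (T : Type) (P : probability Omega R) (X : nat -> Omega -> option T)
    : \bar R :=
  \int[P]_w exit_time X w.

Definition survival (dO : measure_display) (Omega : measurableType dO)
    (T : Type) (P : probability Omega R) (X : nat -> Omega -> option T) (n : nat)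
    : \bar R :=
  P [set w | n%:R%:E < exit_time X w].

(* [P x] is the law of the chain started at [x]; for [x] outside
   [E], [P x] is irrelevant. *)
Definition absorbed_chain (dO : measure_display) (Omega : measurableType dO)
    (T : choiceType) (E : set T) (k : T -> T -> \bar R)
    (P : T -> probability Omega R) (X : nat -> Omega -> option T) : Prop :=
  forall x, E x ->
    markov_chain (with_cemetery E) (completed_kernel E k) (Some x) (P x) X.

Definition irreducible_on (dO : measure_display) (Omega : measurableType dO)
    (T : Type) (E : set T) (P : T -> probability Omega R)
    (X : nat -> Omega -> option T) : Prop :=
  forall x y, E x -> E y -> exists n, 0 < P x [set w | X n w = Some y].

Definition transient_on (dO : measure_display) (Omega : measurableType dO)
    (T : Type) (E : set T) (P : T -> probability Omega R)
    (X : nat -> Omega -> option T) : Prop :=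
  forall x, E x ->
    P x [set w | exists n, (1 <= n)%N /\ X n w = Some x] < 1.

Definition green (dO : measure_display) (Omega : measurableType dO)
    (T : Type) (P : T -> probability Omega R) (X : nat -> Omega -> option T)
    (x y : T) : \bar R :=
  \sum_(0 <= n <oo) P x [set w | X n w = Some y].

Definition renewal_function (dO : measure_display) (Omega : measurableType dO)
    (T : Type) (Q : T -> probability Omega R) (X : nat -> Omega -> option T)
    (x : T) : \bar R :=
  mean_exit_time (Q x) X.

End MarkovChains.

Section Kernels.
Variables (R : realType) (d : nat) (E : set (lattice d)).
Variable p : lattice d -> lattice d -> R.

Definition substochastic : Prop :=
  (forall x y, E x -> E y -> 0 <= p x y) /\
  (forall x, E x -> (\esum_(y in E) (p x y)%:E <= 1)%E).

Definition harmonic_on (h : lattice d -> R) : Prop :=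
  forall x, E x -> (\esum_(y in E) (p x y * h y)%:E)%E = (h x)%:E.

Definition ladder_increment (u x y : lattice d) : R :=
  if y \in [set v + u | v in E] then p (x + u) y - p x (y - u) else p (x + u) y.

(* [G] stands for the Green function of the chain with kernel [p]; note that the
   starting point [x] of the ladder chain is the shift in [ladder_increment].
   [esum] is meant for nonnegative terms: [ladder_increment] is nonnegative when
   [p x y <= p (x + u) (y + u)]. *)
Definition ladder_kernel (G : lattice d -> lattice d -> \bar R)
    (x y : lattice d) : \bar R :=
  (\esum_(z in E) (G 0%R z * (ladder_increment x z y)%:E))%E.

End Kernels.

(* Main.v *)
Require Import Defs.
From mathcomp Require Import all_boot all_order all_algebra.
From mathcomp Require Import all_classical all_reals all_analysis.
From mathcomp Require Import measurable_realfun lra.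
Import Order.TTheory GRing.Theory Num.Theory.
Import numFieldNormedType.Exports.
Local Open Scope classical_set_scope.
Local Open Scope ring_scope.
Set Implicit Arguments.
Unset Strict Implicit.
Unset Printing Implicit Defensive.

(** Why the theorem holds.  Write [P] for the transition operator of the chain,
    [P f x = sum_y p(x,y) f(y)], [L] for the operator of the ladder height
    kernel, and [s_n = P^n 1] for the survival probabilities, so that the mean
    exit time is [tau = sum_n s_n].  Likewise the renewal function is
    [V = sum_n L^n 1]: it is the least nonnegative solution of [w = 1 + L w], and
    every nonnegative [w] with [c + L w <= w] satisfies [c V <= w].

    Everything comes from one way of translating the chain.  For [u] in [E] the
    transitions from [z + u] split into those of the chain at [z], translated by
    [u], and an excess which is exactly the ladder increment:
      [P f (z + u) = A_u f z + P (f (. + u)) z]        ([kop_shift]).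
    Iterating along a sequence with [f_(n+1) = P f_n] and evaluating at [z = 0],
      [f_n(u) = P^n (f_0 (. + u)) 0 + sum_(i < n) P^i (A_u f_(n-i-1)) 0]
    ([shift_expansion]), while [L f u = sum_i P^i (A_u f) 0] because the Green
    function sums the powers of [P] ([kop_ladderE]).

    - With [f_n = h] harmonic and increasing along translations this gives
      [h >= h(0) + L h], hence [h >= h(0) V] ([harmonic_ge_potential]).
    - With [f_n = s_n], nonincreasing in [n], it gives [s_n >= s_n(0) + L_n s_n],
      where [L_n] keeps the first [n] terms of [L].  So [s_n >= s_n(0) V_n] with
      [V_(n+1) = 1 + L_n V_n], and [V_n] increases to [V] ([cvg_Vn]).
    - Summing over time, the truncated mean exit times [tau_n = sum_(i < n) s_i]
      satisfy [tau_n <= tau_n(0) + L tau_n]; being bounded, they are at most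
      [tau_n(0) V] ([mtaun_le_potential]).  In the limit the opposite inequality
      [tau >= tau(0) V] holds as well ([mtau_ge_potential]).

    Infinite mean exit time.  As [tau_n <= m + P^m tau_n], the upper bound on
    [tau_n] yields [tau_n(0) <= m + tau_n(0) P^m V (0)]; since [tau_n(0)] diverges,
    [P^m V (0) >= 1].  In the other direction
    [s_n(0) P^m V_n (0) <= s_(n+m)(0) <= s_n(0)] gives [P^m V (0) <= 1].  Thus
    [P^m] preserves the value of [V] at the origin, and of course that of [h].
    A gap between two ordered functions at a point [x] is seen from the origin
    with weight [p^m(0,x)], positive for some [m] by irreducibility
    ([iter_kop_gap]).  Applied to [h(0) V <= h] this forces equality; applied to
    [s_n(0) V_n <= s_n] it squeezes [s_n(x) / s_n(0)] between two sequences that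
    converge to [V x].

    Finite mean exit time.  From [tau = 1 + P tau] and [tau >= tau(0) V] one gets
    [tau(0) >= 1 + tau(0) P V (0)], so [P V (0) < 1] and no nonzero multiple of [V]
    is harmonic.

    The remaining work is to express the laws of the chains through powers of
    their kernels: [markov_law], [survivalE] and [mean_exit_timeE]. *)

(** * Sums of nonnegative extended reals over arbitrary index sets *)

Section esum_extra.
Context {R : realType}.
Local Open Scope ereal_scope.

Lemma esum_exchange (T1 T2 : choiceType) (I : set T1) (J : set T2)
    (a : T1 -> T2 -> \bar R) :
  (forall i j, I i -> J j -> 0 <= a i j) ->
  \esum_(i in I) \esum_(j in J) a i j = \esum_(j in J) \esum_(i in I) a i j.
Proof.
move=> a0.
rewrite (esum_esum (J := fun=> J))//.
rewrite (esum_esum (J := fun=> I) (a := fun j i => a i j)); last first.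
  by move=> *; exact: a0.
rewrite (@reindex_esum _ _ _ (J `*`` (fun=> I)) _ (fun k => (k.2, k.1)))//.
split => [[j i] [/= Jj Ii]//|[i j] [i' j'] _ _ [-> ->]//|[i j] [/= Ii Jj]].
by exists (j, i).
Qed.

Lemma esum_ge_term (T : choiceType) (I : set T) (a : T -> \bar R) i :
  (forall i, I i -> 0 <= a i) -> I i -> a i <= \esum_(j in I) a j.
Proof.
move=> a0 Ii; apply: esum_ge; exists [set i]; last by rewrite fsbig_set1.
by split; [exact: finite_set1|move=> _ ->].
Qed.

Lemma ge0_esumZl (T : choiceType) (I : set T) (c : \bar R) (a : T -> \bar R) :
  0 <= c -> (forall i, I i -> 0 <= a i) ->
  \esum_(i in I) (c * a i) = c * \esum_(i in I) a i.
Proof.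
move=> c0 a0.
have fsumZ X : fsets I X -> \sum_(i \in X) (c * a i) = c * \sum_(i \in X) a i.
  move=> [finX XI]; rewrite !fsbig_finite// big_seq_cond [in RHS]big_seq_cond.
  rewrite ge0_sume_distrr// => i.
  by rewrite in_fset_set// andbT => /set_mem/XI/a0.
apply/eqP; rewrite eq_le; apply/andP; split.
  apply: ge_ereal_sup => _ [X IX <-].
  by rewrite fsumZ// lee_wpmul2l// ereal_sup_ubound//; exists X.
case: c c0 fsumZ => [r| |]// c0 fsumZ.
  rewrite /esum -ereal_supZl//; last first.
    apply/set0P; exists (\sum_(i \in set0) a i); exists set0 => //.
    exact: fsets_set0.
  apply: ge_ereal_sup => _ [_ [X IX <-] <-]; rewrite -fsumZ//.
  by apply: ereal_sup_ubound; exists X.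
have [->|an0] := eqVneq (\esum_(i in I) a i) 0.
  by rewrite mule0 esum_ge0// => i Ii; rewrite mule_ge0// a0.
have : 0 < \esum_(i in I) a i by rewrite lt0e an0 esum_ge0.
move=> /ereal_sup_gt[_ [X IX <-]] aX.
by apply: esum_ge; exists X => //; rewrite fsumZ// (gt0_mulye aX) leey.
Qed.

(** Monotone convergence: it holds for the finite partial sums, whose supremum is
    the sum. *)
Lemma esum_ereal_sup (T : choiceType) (I : set T) (f : nat -> T -> \bar R) :
  (forall n i, I i -> 0 <= f n i) ->
  (forall i, I i -> nondecreasing_seq (f^~ i)) ->
  \esum_(i in I) ereal_sup (range (f^~ i)) =
  ereal_sup (range (fun n => \esum_(i in I) f n i)).
Proof.
move=> f0 fnd; apply/eqP; rewrite eq_le; apply/andP; split.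
  apply: ge_ereal_sup => _ [X [finX XI] <-].
  rewrite fsbig_finite//.
  have cvgX : \sum_(i <- finmap.enum_fset (fset_set X)) f n i @[n --> \oo] -->
      \sum_(i <- finmap.enum_fset (fset_set X)) ereal_sup (range (f^~ i)).
    rewrite big_seq; under eq_cvg do rewrite big_seq.
    apply: cvg_nnesum => i; rewrite in_fset_set// => /set_mem/XI Ii.
      by apply: nearW => n; exact: f0.
    exact/ereal_nondecreasing_cvgn/fnd.
  apply: (cvge_le _ cvgX); apply: nearW => n.
  apply: (@le_trans _ _ (\esum_(i in I) f n i)).
    by apply: esum_ge; exists X => //; rewrite fsbig_finite.
  by apply: ereal_sup_ubound; exists n.
apply: ge_ereal_sup => _ [n _ <-]; apply: le_esum => i Ii.
by apply: ereal_sup_ubound; exists n.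
Qed.

Lemma ereal_sup_rangeZl (c : \bar R) (u : nat -> \bar R) :
  0 <= c -> c \is a fin_num ->
  ereal_sup (range (fun n => c * u n)) = c * ereal_sup (range u).
Proof.
case: c => [r| |]// r0 _; rewrite -ereal_supZl//; last first.
  by apply/set0P; exists (u 0%N); exists 0%N.
congr ereal_sup; apply/seteqP; split => [_ [n _ <-]|_ [_ [n _ <-] <-]].
  by exists (u n) => //; exists n.
by exists n.
Qed.

End esum_extra.

(** * The operator of a nonnegative kernel *)

Section kernel_operator.
Context {R : realType} {T : choiceType} (E : set T).
Local Open Scope ereal_scope.
Implicit Types (k : T -> T -> \bar R) (f g : T -> \bar R) (c : \bar R).

Definition kop k f x : \bar R := \esum_(y in E) (k x y * f y).

Fixpoint kpow k (n : nat) (x y : T) : \bar R :=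
  if n is m.+1 then \esum_(z in E) (kpow k m x z * k z y)
  else (x == y)%:R%:E.

Definition nonneg f := forall x, E x -> 0 <= f x.

Definition nonneg_kernel k := forall x y, E x -> E y -> 0 <= k x y.

Variable k : T -> T -> \bar R.
Hypothesis k0 : nonneg_kernel k.

Lemma kop_ge0 f : nonneg f -> nonneg (kop k f).
Proof. by move=> f0 x Ex; apply: esum_ge0 => y Ey; rewrite mule_ge0 ?k0 ?f0. Qed.

Lemma le_kop f g : (forall x, E x -> f x <= g x) ->
  forall x, E x -> kop k f x <= kop k g x.
Proof.
by move=> fg x Ex; apply: le_esum => y Ey; rewrite lee_wpmul2l ?k0 ?fg.
Qed.

Lemma eq_kop f g : (forall x, E x -> f x = g x) ->
  forall x, kop k f x = kop k g x.
Proof.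
by move=> fg x; apply: eq_esum => y Ey; rewrite fg.
Qed.

Lemma kopD f g : nonneg f -> nonneg g ->
  forall x, E x -> kop k (f \+ g) x = kop k f x + kop k g x.
Proof.
move=> f0 g0 x Ex; rewrite -esumD => [|y Ey|y Ey]; last 2 first.
- by rewrite mule_ge0 ?k0 ?f0.
- by rewrite mule_ge0 ?k0 ?g0.
by apply: eq_esum => y Ey; rewrite ge0_muleDr ?f0 ?g0.
Qed.

Lemma kop_sum (r : seq nat) (f : nat -> T -> \bar R) :
  (forall i, nonneg (f i)) -> forall x, E x ->
  kop k (fun y => \sum_(i <- r) f i y) x = \sum_(i <- r) kop k (f i) x.
Proof.
move=> f0 x Ex; rewrite -esum_sum => [|y i Ey _]; last first.
  by rewrite mule_ge0 ?k0 ?f0.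
by apply: eq_esum => y Ey; rewrite ge0_sume_distrr// => i _; rewrite f0.
Qed.

Lemma kopZ c f : 0 <= c -> nonneg f ->
  forall x, E x -> kop k (fun y => c * f y) x = c * kop k f x.
Proof.
move=> c0 f0 x Ex; rewrite -ge0_esumZl// => [|y Ey].
  by apply: eq_esum => y Ey; rewrite muleCA.
by rewrite mule_ge0 ?k0 ?f0.
Qed.

Lemma kop_nneseries (f : nat -> T -> \bar R) :
  (forall i, nonneg (f i)) -> forall x, E x ->
  kop k (fun y => \sum_(i <oo) f i y) x = \sum_(i <oo) kop k (f i) x.
Proof.
move=> f0 x Ex; rewrite nneseries_esumT; last by move=> i; exact: kop_ge0.
rewrite esum_exchange; last by move=> i y _ Ey; rewrite mule_ge0 ?k0 ?f0.
apply: eq_esum => y Ey; rewrite nneseries_esumT => [|i]; last exact: f0.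
by rewrite ge0_esumZl ?k0// => i _; rewrite f0.
Qed.

(** Monotone convergence.  Finite entries are required because multiplication by
    [+oo] is not continuous at [0]. *)
Lemma cvg_kop (f : nat -> T -> \bar R) g :
  (forall x y, E x -> E y -> k x y \is a fin_num) ->
  (forall n, nonneg (f n)) ->
  (forall x, E x -> nondecreasing_seq (f^~ x)) ->
  (forall x, E x -> f^~ x @ \oo --> g x) ->
  forall x, E x -> kop k (f n) x @[n --> \oo] --> kop k g x.
Proof.
move=> kfin f0 fnd fg x Ex.
have gE y : E y -> g y = ereal_sup (range (f^~ y)).
  move=> Ey; apply: (cvg_unique _ (fg _ Ey)) => //.
  exact/ereal_nondecreasing_cvgn/fnd.
have -> : kop k g x = ereal_sup (range (fun n => kop k (f n) x)).
  rewrite -esum_ereal_sup => [|n y Ey|y Ey m n mn]; last 2 first.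
  - by rewrite mule_ge0 ?k0 ?f0.
  - by rewrite lee_wpmul2l ?k0// fnd.
  by apply: eq_esum => y Ey; rewrite ereal_sup_rangeZl ?k0 ?kfin ?gE.
apply: ereal_nondecreasing_cvgn => m n mn; apply: le_kop => // y Ey.
exact: fnd.
Qed.

Lemma iter_kop_ge0 n f : nonneg f -> nonneg (iter n (kop k) f).
Proof. by move=> f0; elim: n => //= n; exact: kop_ge0. Qed.

Lemma le_iter_kop n f g : (forall x, E x -> f x <= g x) ->
  forall x, E x -> iter n (kop k) f x <= iter n (kop k) g x.
Proof. by move=> fg; elim: n => //= n; exact: le_kop. Qed.

Lemma eq_iter_kop n f g : (forall x, E x -> f x = g x) ->
  forall x, E x -> iter n (kop k) f x = iter n (kop k) g x.
Proof.
move=> fg x Ex; apply/eqP; rewrite eq_le.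
by rewrite !le_iter_kop// => y Ey; rewrite fg.
Qed.

Lemma iter_kopD n f g : nonneg f -> nonneg g ->
  forall x, E x ->
  iter n (kop k) (f \+ g) x = iter n (kop k) f x + iter n (kop k) g x.
Proof.
move=> f0 g0; elim: n => //= n IH x Ex.
by rewrite -kopD//; [rewrite (eq_kop IH)|exact: iter_kop_ge0..].
Qed.

Lemma iter_kopZ n c f : 0 <= c -> nonneg f ->
  forall x, E x -> iter n (kop k) (fun y => c * f y) x = c * iter n (kop k) f x.
Proof.
move=> c0 f0; elim: n => //= n IH x Ex.
by rewrite -kopZ//; [rewrite (eq_kop IH)|exact: iter_kop_ge0].
Qed.

Lemma cvg_iter_kop m (f : nat -> T -> \bar R) g :
  (forall x y, E x -> E y -> k x y \is a fin_num) ->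
  (forall n, nonneg (f n)) ->
  (forall x, E x -> nondecreasing_seq (f^~ x)) ->
  (forall x, E x -> f^~ x @ \oo --> g x) ->
  forall x, E x -> iter m (kop k) (f n) x @[n --> \oo] --> iter m (kop k) g x.
Proof.
move=> kfin f0 fnd fg; elim: m => [|m IH]//= x Ex.
apply: (@cvg_kop (fun n => iter m (kop k) (f n))) => //.
- by move=> n; exact: iter_kop_ge0.
- by move=> y Ey i j ij; apply: le_iter_kop => // z Ez; exact: fnd.
Qed.

Lemma kpow_ge0 n : nonneg_kernel (kpow k n).
Proof.
move=> x + Ex; elim: n => [|n IH] y Ey /=; first by rewrite lee_fin ler0n.
by apply: esum_ge0 => z Ez; rewrite mule_ge0 ?IH ?k0.
Qed.

Lemma kop_kpow n f : nonneg f ->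
  forall x, E x -> kop (kpow k n) f x = iter n (kop k) f x.
Proof.
move=> + x Ex; elim: n f => [|n IH] f f0; rewrite {1}/kop /=.
  rewrite (esumID [set x]) => [|y Ey]; last first.
    by rewrite mule_ge0 ?lee_fin ?ler0n ?f0.
  rewrite setIidr; last by move=> _ ->.
  rewrite esum_set1 eqxx mul1e ?f0//.
  by rewrite esum1 ?adde0// => y [Ey /eqP xy]; rewrite eq_sym (negbTE xy) mul0e.
rewrite -iterS iterSr -IH; last exact: kop_ge0.
transitivity (\esum_(y in E) \esum_(z in E) (kpow k n x z * (k z y * f y))).
  apply: eq_esum => y Ey; rewrite muleC -ge0_esumZl ?f0//; last first.
    by move=> z Ez; rewrite mule_ge0 ?kpow_ge0 ?k0.
  by apply: eq_esum => z Ez; rewrite muleC muleA.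
rewrite esum_exchange => [|y z Ey Ez]; last first.
  by rewrite !mule_ge0 ?kpow_ge0 ?k0 ?f0.
apply: eq_esum => z Ez; rewrite ge0_esumZl ?kpow_ge0// => y Ey.
by rewrite mule_ge0 ?k0 ?f0.
Qed.

(** A gap between [f] and [g] at a point is still seen after [n] steps, with the
    weight of that point. *)
Lemma iter_kop_gap n f g z x : nonneg f -> (forall y, E y -> f y <= g y) ->
  f x \is a fin_num -> E z -> E x ->
  iter n (kop k) f z + kpow k n z x * (g x - f x) <= iter n (kop k) g z.
Proof.
move=> f0 fg ffin Ez Ex.
pose gap y := if y == x then g x - f x else 0.
have gap0 : nonneg gap.
  move=> y _; rewrite /gap; case: eqP => // _.
  by rewrite sube_ge0 ?fg// ffin.
apply: (@le_trans _ _ (iter n (kop k) (f \+ gap) z)).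
  rewrite iter_kopD// leeD2l// -[leRHS]kop_kpow//.
  have -> : kpow k n z x * (g x - f x) = kpow k n z x * gap x.
    by rewrite /gap eqxx.
  apply: (@esum_ge_term _ _ E (fun y => kpow k n z y * gap y)) => // y Ey.
  by rewrite mule_ge0 ?kpow_ge0 ?gap0.
apply: le_iter_kop => // y Ey; rewrite /= /gap; case: eqP => [->|_].
  by rewrite addeC subeK.
by rewrite adde0 fg.
Qed.

End kernel_operator.

(** * Mass and potential of a kernel *)

Section potential.
Context {R : realType} {T : choiceType} (E : set T).
Local Open Scope ereal_scope.
Variable k : T -> T -> \bar R.
Hypothesis k0 : nonneg_kernel E k.

(** [mass n x] is the probability that the chain killed with its missing mass is
    still alive at time [n], so that [potential x] is its mean life time. *)
Definition mass n : T -> \bar R := iter n (kop E k) (cst 1).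

Definition potential x : \bar R := \sum_(n <oo) mass n x.

Definition partial_potential n x : \bar R := \sum_(0 <= i < n) mass i x.

Lemma mass_ge0 n : nonneg E (mass n).
Proof. by apply: iter_kop_ge0 => // x _; exact: lee01. Qed.

Lemma partial_potential_ge0 n : nonneg E (partial_potential n).
Proof. by move=> x Ex; apply: sume_ge0 => i _; exact: mass_ge0. Qed.

Lemma partial_potential_nd x : E x -> nondecreasing_seq (partial_potential^~ x).
Proof.
by move=> Ex; apply: ereal_nondecreasing_series => i _ _; exact: mass_ge0.
Qed.

Lemma cvg_partial_potential x : E x ->
  partial_potential^~ x @ \oo --> potential x.
Proof.
by move=> Ex; apply: is_cvg_nneseries => n _ _; exact: mass_ge0.
Qed.

Lemma partial_potential_le x n : E x -> partial_potential n x <= potential x.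
Proof.
by move=> Ex; apply: nneseries_lim_ge => i _ _; exact: mass_ge0.
Qed.

Lemma potential_ge0 : nonneg E potential.
Proof. by move=> x Ex; apply: nneseries_ge0 => n _ _; exact: mass_ge0. Qed.

Lemma partial_potential0 x : partial_potential 0 x = 0.
Proof. by rewrite /partial_potential big_nil. Qed.

Lemma partial_potentialS n x : E x ->
  partial_potential n.+1 x = 1 + kop E k (partial_potential n) x.
Proof.
move=> Ex; rewrite /partial_potential big_nat_recl//; congr (_ + _).
by rewrite kop_sum// => i; exact: mass_ge0.
Qed.

Lemma potentialE x : E x -> potential x = 1 + kop E k potential x.
Proof.
move=> Ex; rewrite [in RHS]/potential kop_nneseries//; last exact: mass_ge0.
rewrite /potential nneseries_recl//; last by move=> n _; exact: mass_ge0.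
congr (_ + _); rewrite -(nneseries_addn 1%N)//=; last first.
  by move=> i; exact: mass_ge0.
by apply: eq_eseriesr => i _; rewrite addn1.
Qed.

(** The partial potentials are the iterates of [w |-> 1 + k w] from [0], so they
    stay below any nonnegative supersolution. *)
Lemma potential_le_supersolution c w : 0 <= c ->
  (forall x, E x -> c + kop E k w x <= w x) -> nonneg E w ->
  forall x, E x -> c * potential x <= w x.
Proof.
move=> c0 cw w0 x Ex.
have partial n : forall y, E y -> c * partial_potential n y <= w y.
  elim: n => [|n IH] y Ey.
    by rewrite partial_potential0 mule0 w0.
  rewrite partial_potentialS// ge0_muleDr ?mule1//; last first.
    by rewrite kop_ge0//; exact: partial_potential_ge0.
  apply: le_trans (cw _ Ey); rewrite leeD2l//.
  rewrite -kopZ//; first exact: le_kop.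
  exact: partial_potential_ge0.
case: c c0 partial {cw} => [c| |]// c0 partial.
  have := cvgeZl (y := c%:E) erefl (cvg_partial_potential Ex).
  by apply: cvge_le; apply: nearW => n; exact: partial.
have := partial 1%N _ Ex; rewrite partial_potentialS// gt0_mulye; last first.
  rewrite (@lt_le_trans _ _ 1)// leeDl// kop_ge0//.
  exact: partial_potential_ge0.
by rewrite leye_eq => /eqP ->; exact: leey.
Qed.

(** Iterating [w <= c + k w] leaves a remainder [k^n w], dominated for bounded [w]
    by a multiple of [mass n], the general term of a convergent series. *)
Lemma subsolution_le_potential (c M : R) w : (0 <= M)%R ->
  (forall x, E x -> w x <= c%:E + kop E k w x) -> (0 <= c)%R ->
  (forall x, E x -> w x <= M%:E) ->
  forall x, E x -> potential x < +oo -> w x <= c%:E * potential x.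
Proof.
move=> M0 cw c0 wM x Ex potoo.
have bound n : forall y, E y ->
    w y <= c%:E * partial_potential n y + M%:E * mass n y.
  elim: n => [|n IH] y Ey.
    by rewrite partial_potential0 mule0 add0e mule1 wM.
  rewrite partial_potentialS// ge0_muleDr ?mule1//; last first.
    by rewrite kop_ge0//; exact: partial_potential_ge0.
  apply: le_trans (cw _ Ey) _; rewrite -addeA leeD2l//.
  rewrite -[M%:E * _]kopZ//; last exact: mass_ge0.
  rewrite -[X in _ <= X + _]kopZ//; last exact: partial_potential_ge0.
  rewrite -kopD//.
  - exact: le_kop.
  - by move=> z Ez; rewrite mule_ge0// partial_potential_ge0.
  - by move=> z Ez; rewrite mule_ge0// mass_ge0.
have potfin : potential x \is a fin_num by rewrite ge0_fin_numE// potential_ge0.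
have ppfin n : partial_potential n x \is a fin_num.
  rewrite ge0_fin_numE ?partial_potential_ge0//.
  exact: le_lt_trans (partial_potential_le n Ex) potoo.
have pp := cvg_partial_potential Ex.
have mass_cvg0 : mass n x @[n --> \oo] --> 0.
  have -> : mass^~ x =
      (fun n => partial_potential n.+1 x - partial_potential n x).
    apply/funext => n; rewrite /partial_potential big_nat_recr//=.
    by rewrite [X in X - _]addeC addeK//; exact: ppfin.
  rewrite -(subee potfin); apply: cvgeB => //.
    by rewrite fin_num_adde_defl// fin_numN.
  by rewrite (cvg_shiftS (partial_potential^~ x)).
rewrite -[leRHS]adde0 -(mule0 M%:E).
apply: (cvge_ge _ (cvgeD _ (cvgeZl _ pp) (cvgeZl _ mass_cvg0))) => //.
  by apply: nearW => n; exact: bound.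
by rewrite fin_num_adde_defl// mule0.
Qed.

End potential.

(** * Laws of an absorbed chain in terms of its kernel *)

Section markov_chain_laws.
Context {R : realType} {dO : measure_display} {Omega : measurableType dO}.
Context {T : countType} (E : set T).
Local Open Scope ereal_scope.
Variable K : T -> T -> \bar R.
Hypothesis K0 : nonneg_kernel E K.

(** A discrete random variable cuts an event into countably many pieces; the
    values are numbered by [pickle] to use countable additivity. *)
Lemma esum_preimage (P : probability Omega R) (S : countType)
    (X : Omega -> S) (D : set S) (A : set Omega) :
  (forall w, D (X w)) -> (forall s, measurable [set w | X w = s]) ->
  measurable A ->
  P A = \esum_(s in D) P (A `&` [set w | X w = s]).
Proof.
move=> DX mX mA.
pose F k := A `&` [set w | pickle (X w) = k].
have FE s : F (pickle s) = A `&` [set w | X w = s].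
  congr (_ `&` _); apply/seteqP; split => w /=; last by move=> ->.
  exact: (pcan_inj pickleK).
have AE : A = \bigcup_(k in pickle @` D) F k.
  apply/seteqP; split => [w Aw|w [k _ []]//].
  by exists (pickle (X w)) => //; exists (X w).
rewrite [in LHS]AE measure_bigcup; last 2 first.
- by move=> _ [s _ <-]; rewrite FE; exact: measurableI.
- by move=> i j _ _ [w [[_ <-] [_ <-]]].
rewrite nneseries_esum// set_mem_set esum_image; last first.
  by move=> s t _ _; exact: (pcan_inj pickleK).
by apply: eq_esum => s _; rewrite FE.
Qed.

Lemma esum_cemetery (a : option T -> \bar R) : a None = 0 ->
  \esum_(s in with_cemetery E) a s = \esum_(x in E) a (Some x).
Proof.
move=> aN; rewrite -(@esum_image _ _ _ E Some); last by move=> x y _ _ [].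
rewrite esum_mkcond [RHS]esum_mkcond; apply: eq_esum => -[x|] _; last first.
  by rewrite aN; do 2 case: ifP.
congr (if _ then _ else _); apply/idP/idP => /set_mem /= Ex; apply/mem_set.
  by exists x.
by case: Ex => y Ey [<-].
Qed.

Variables (x0 : T) (P : probability Omega R) (X : nat -> Omega -> option T).
Hypothesis Ex0 : E x0.
Hypothesis mcX :
  markov_chain (with_cemetery E) (completed_kernel E K) (Some x0) P X.

Let inS n w : with_cemetery E (X n w). Proof. by case: mcX. Qed.
Let mX n s : measurable [set w | X n w = s]. Proof. by case: mcX. Qed.

Let mXN n : measurable [set w | X n w <> None].
Proof.
by rewrite -[X in measurable X]/(~` [set w | X n w = None]); exact: measurableC.
Qed.

(** Summing out the coordinates before [j] turns the law of a whole trajectory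
    into the law of its final segment.  The transition weight has to be
    nonnegative to leave the sum: [completed_kernel] gives a negative weight to
    absorption where the kernel has mass above [1]. *)
Lemma markov_segment j n (s : nat -> option T) : (j <= n)%N ->
  (forall i, with_cemetery E (s i)) ->
  0 <= completed_kernel E K (s n) (s n.+1) ->
  P [set w | forall i, (j <= i <= n.+1)%N -> X i w = s i] =
  P [set w | forall i, (j <= i <= n)%N -> X i w = s i] *
    completed_kernel E K (s n) (s n.+1).
Proof.
have mseg a b u : measurable [set w | forall i, (a <= i <= b)%N -> X i w = u i].
  rewrite (_ : [set w | _] =
      \bigcap_(i in [set i | (a <= i <= b)%N]) [set w | X i w = u i]).
    by apply: bigcap_measurableType => i _; exact: mX.
  by apply/seteqP; split.
elim: j s => [|j IH] s jn Ss k0.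
  by case: mcX => _ _ _ /(_ n s Ss).
have split_j m : (j <= m)%N -> forall c,
    [set w | forall i, (j.+1 <= i <= m)%N -> X i w = s i] `&`
      [set w | X j w = c] =
    [set w | forall i, (j <= i <= m)%N ->
      X i w = if i == j then c else s i].
  move=> jm c; apply/seteqP; split => [w [/= h jc] i|w /= h].
    have [->//|ij /andP[ji im]] := eqVneq i j.
    by apply: h; rewrite im andbT ltn_neqAle eq_sym ij.
  split => [i /andP[ji im]|].
    by have := h i; rewrite (gtn_eqF ji) im (ltnW ji); apply.
  by have := h j; rewrite eqxx leqnn jm; apply.
rewrite (esum_preimage P (inS j) (mX j))//.
rewrite [in RHS](esum_preimage P (inS j) (mX j))//.
rewrite muleC -ge0_esumZl//.
apply: eq_esum => c Sc; rewrite !split_j//; [|exact: ltnW|exact: leqW (ltnW jn)].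
have := IH (fun i => if i == j then c else s i) (ltnW jn).
rewrite (gtn_eqF jn) (gtn_eqF (leqW jn)) muleC; apply => // i.
by case: ifP.
Qed.

Lemma markov_step n a b : with_cemetery E a -> with_cemetery E b ->
  0 <= completed_kernel E K a b ->
  P ([set w | X n w = a] `&` [set w | X n.+1 w = b]) =
  P [set w | X n w = a] * completed_kernel E K a b.
Proof.
move=> Sa Sb k0.
have Ss i : with_cemetery E (if i == n then a else b) by case: ifP.
have := @markov_segment n n (fun i => if i == n then a else b) (leqnn n) Ss.
rewrite eqxx (gtn_eqF (ltnSn n)) => /(_ k0).
rewrite [X in _ = P X * _](_ : _ = [set w | X n w = a]); last first.
  apply/seteqP; split => w /=.
    by move=> /(_ n); rewrite eqxx leqnn; apply.
  by move=> Xn i; rewrite -eqn_leq => /eqP <-; rewrite eqxx.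
move=> <-; congr (P _); apply/seteqP; split => [w [/= Xn XSn] i|w /= h].
  have [->//|ni] := eqVneq i n.
  rewrite [(n <= i)%N]leq_eqVlt eq_sym (negbTE ni) /= -eqn_leq.
  by move=> /eqP <-.
split; first by have := h n; rewrite eqxx leqnn leqnSn; apply.
by have := h n.+1; rewrite (gtn_eqF (ltnSn n)) leqnn leqnSn; apply.
Qed.

Lemma markov_initial s : s <> Some x0 -> P [set w | X 0%N w = s] = 0.
Proof.
move=> sx0; have P1 : P [set w | X 0%N w = Some x0] = 1 by case: mcX.
apply: (@subset_measure0 _ _ _ P _ (~` [set w | X 0%N w = Some x0])).
- exact: mX.
- exact/measurableC/mX.
- by move=> w /= -> /esym /esym.
by have := probability_setC P (mX 0%N (Some x0)); rewrite P1 subee.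
Qed.

Lemma markov_law n y : E y -> P [set w | X n w = Some y] = kpow E K n x0 y.
Proof.
elim: n y => [|n IH] y Ey /=.
  case: eqVneq => [<-|x0y]; first by case: mcX.
  by rewrite markov_initial// => -[] /eqP; rewrite eq_sym (negbTE x0y).
rewrite (esum_preimage P (inS n) (mX n))//.
have step a : with_cemetery E a -> 0 <= completed_kernel E K a (Some y) ->
    P ([set w | X n.+1 w = Some y] `&` [set w | X n w = a]) =
    P [set w | X n w = a] * completed_kernel E K a (Some y).
  by move=> Sa k0; rewrite setIC markov_step.
rewrite esum_cemetery; last by rewrite step//= mule0.
by apply: eq_esum => z Ez; rewrite step//= ?K0// IH.
Qed.

Let alive n := [set w | forall t, (1 <= t <= n)%N -> X t w <> None].

Lemma measurable_alive n : measurable (alive n).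
Proof.
rewrite (_ : alive n =
    \bigcap_(t in [set t | (1 <= t <= n)%N]) [set w | X t w <> None]).
  by apply: bigcap_measurableType => t _; exact: mXN.
by apply/seteqP; split.
Qed.

Lemma cemetery_absorbing n :
  P ([set w | X n.+1 w <> None] `&` [set w | X n w = None]) = 0.
Proof.
rewrite (esum_preimage P (inS n.+1) (mX n.+1)); last exact: measurableI.
apply: esum1 => -[y|] Sy; last first.
  by rewrite (_ : _ `&` _ = set0)// -subset0 => w [[/= ? _]].
apply: (@subset_measure0 _ _ _ P _
  ([set w | X n w = None] `&` [set w | X n.+1 w = Some y])).
- by apply: measurableI => //; exact: measurableI.
- exact: measurableI.
- by move=> w [[_ ?] ?].
by have := @markov_step n None (Some y) I Sy (lexx _); rewrite /= mule0.
Qed.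

(** By induction on [n]: a step out of the cemetery has weight [0]. *)
Lemma no_resurrection n : P ([set w | X n w <> None] `\` alive n) = 0.
Proof.
have mD m : measurable ([set w | X m w <> None] `\` alive m).
  by apply: measurableD => //; exact: measurable_alive.
elim: n => [|n IH].
  by rewrite (_ : _ `\` _ = set0)// -subset0 => w [_ /=]; apply => -[].
pose N := [set w | X n.+1 w <> None] `&` [set w | X n w = None].
have mN : measurable N by exact: measurableI.
apply: (@subset_measure0 _ _ _ P _
    (([set w | X n w <> None] `\` alive n) `|` N)) => //.
- exact: measurableU.
- move=> w [/= XSn dead]; have [Xn|Xn] := eqVneq (X n w) None; first by right.
  left; split => /=; first exact/eqP.
  move=> al; apply: dead => t /andP[t1]; rewrite leq_eqVlt => /predU1P[->//|].
  by rewrite ltnS => tn; apply: al; rewrite t1.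
- by apply: null_set_setU => //; exact: cemetery_absorbing.
Qed.

Lemma P_alive n : P (alive n) = mass E K n x0.
Proof.
have mA := measurable_alive n.
transitivity (P [set w | X n w <> None]).
  rewrite (measureDI P mA (mXN n)) (measureDI P (mXN n) mA) setIC; congr (_ + _).
  transitivity (0 : \bar R); last exact/esym/no_resurrection.
  apply: (@subset_measure0 _ _ _ P _ [set w | X 0%N w = None]) => //.
  - exact: measurableD.
  (* the exit time only looks at times [t >= 1], so time [0] is apart *)
  - move=> w [al /contrapT Xn] /=; case: n al Xn {mA} => // n al Xn.
    by have := al n.+1; rewrite /= leqnn => /(_ isT).
  - exact: markov_initial.
rewrite (esum_preimage P (inS n) (mX n))// esum_cemetery; last first.
  by rewrite (_ : _ `&` _ = set0)// -subset0 => w [].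
rewrite /mass -kop_kpow//; apply: eq_esum => y Ey.
rewrite mule1 -markov_law//; congr (P _).
by apply/seteqP; split => [w []//|w Xn]; split => //=; rewrite Xn.
Qed.

Lemma exit_timeP w :
  (exit_time R X w = +oo :> \bar R /\ forall t, (1 <= t)%N -> X t w <> None) \/
  exists m, [/\ exit_time R X w = m%:R%:E :> \bar R, (1 <= m)%N, X m w = None &
    forall t, (1 <= t < m)%N -> X t w <> None].
Proof.
have [ex|nex] := pselect (exists t, (1 <= t)%N && (X t w == None)); last first.
  have noexit t : (1 <= t)%N -> X t w <> None.
    by move=> t1 /eqP Xt; apply: nex; exists t; rewrite t1.
  left; split => //; rewrite /exit_time.
  rewrite [X in ereal_inf X](_ : _ = set0) ?ereal_inf0//.
  by rewrite -subset0 => r [t [t1 Xt] _]; exact: (noexit t t1 Xt).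
right; case: (ex_minnP ex) => m /andP[m1 /eqP Xm] mmin; exists m; split => //.
  apply/eqP; rewrite eq_le; apply/andP; split.
    by apply: ereal_inf_lbound; exists m.
  apply: le_ereal_inf_tmp => _ [t [t1 Xt] <-].
  by rewrite lee_fin ler_nat mmin// t1 Xt/=.
move=> t /andP[t1 tm] Xt; have := mmin t; rewrite t1 Xt eqxx => /(_ isT).
by rewrite leqNgt tm.
Qed.

Lemma lt_exit_timeE n : [set w | n%:R%:E < exit_time R X w :> \bar R] = alive n.
Proof.
apply/seteqP; split => w /=.
  have [[_ al] _ t /andP[t1 _]|[m [-> m1 Xm al]]] := exit_timeP w.
    exact: al.
  rewrite lte_fin ltr_nat => nm t /andP[t1 tn].
  by apply: al; rewrite t1 (leq_ltn_trans tn).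
have [[-> _] _|[m [-> m1 Xm _]] al] := exit_timeP w; first exact: ltry.
rewrite lte_fin ltr_nat ltnNge; apply/negP => mn.
by apply: (al m) => //; rewrite m1.
Qed.

Lemma exit_time_series w :
  exit_time R X w = \sum_(n <oo) (\1_(alive n) w)%:E :> \bar R.
Proof.
have i0 n : 0 <= (\1_(alive n) w)%:E :> \bar R by rewrite lee_fin.
have [[-> al]|[m [-> m1 Xm al]]] := exit_timeP w.
  apply/esym/eq_infty => r.
  have [k rk] : exists k : nat, (r <= k%:R)%R.
    exists (Num.bound `|r|%R); apply: le_trans (ler_norm r) _.
    exact: ltW (archi_boundP (normr_ge0 r)).
  apply: (@le_trans _ _ (\sum_(0 <= n < k) (\1_(alive n) w)%:E)); last first.
    exact: nneseries_lim_ge.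
  rewrite (eq_bigr (fun=> 1)).
    by rewrite sumEFin big_const_nat subn0 iter_addr addr0 lee_fin.
  move=> n _; rewrite indicE mem_set// => t /andP[t1 _]; exact: al.
rewrite (nneseries_split 0 m)// add0n eseries0 ?adde0 => [|n mn _].
  rewrite big_nat_cond (eq_bigr (fun=> 1)).
    by rewrite -big_nat_cond sumEFin big_const_nat subn0 iter_addr addr0.
  move=> n /andP[/andP[_ nm] _]; rewrite indicE mem_set// => t /andP[t1 tn].
  by apply: al; rewrite t1 (leq_ltn_trans tn).
by rewrite indicE memNset// => /(_ m); rewrite m1 mn => /(_ isT).
Qed.

Lemma survivalE n : survival P X n = mass E K n x0.
Proof. by rewrite /survival lt_exit_timeE P_alive. Qed.

Lemma mean_exit_timeE : mean_exit_time P X = potential E K x0.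
Proof.
rewrite /mean_exit_time; under eq_integral do rewrite exit_time_series.
rewrite integral_nneseries//; last first.
  move=> n; apply/measurable_EFinP/measurable_indic; exact: measurable_alive.
apply: eq_eseriesr => n _; rewrite integral_indic//; last exact: measurable_alive.
by rewrite setIT; exact: P_alive.
Qed.

End markov_chain_laws.

(** * The ladder height kernel of a chain that increases along translations *)

Section ladder.
Context {R : realType} {d : nat} (E : set (lattice d)).
Variable p : lattice d -> lattice d -> R.
Hypothesis hp : substochastic E p.
Hypothesis E0 : E 0.
Hypothesis E_shift : forall u, E u -> [set x + u | x in E] `<=` E.
Hypothesis p_shift :
  forall u x y, E u -> E x -> E y -> p x y <= p (x + u) (y + u).
Local Open Scope ereal_scope.

Let pE x y := (p x y)%:E.
Let P := kop E pE.
Let incr u x y := (ladder_increment E p u x y)%:E.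
Let excess u := kop E (incr u).

Let E_D x u : E x -> E u -> E (x + u)%R.
Proof. by move=> Ex Eu; apply: (E_shift Eu); exists x. Qed.

Lemma pE_ge0 : nonneg_kernel E pE.
Proof. by move=> x y Ex Ey; rewrite lee_fin hp.1. Qed.

Lemma ladder_increment_ge0 u : E u -> nonneg_kernel E (incr u).
Proof.
move=> Eu x y Ex Ey; rewrite lee_fin /ladder_increment.
case: ifPn => [/set_mem[v Ev <-]|_].
  by rewrite addrK subr_ge0 p_shift.
by apply: hp.1 => //; exact: E_D.
Qed.

(** Conditioning on the first step from [z + u]: the moves common to the chain
    and to its translate are those of the chain started at [z], the excess is
    carried by the ladder increments. *)
Lemma kop_shift u f : E u -> nonneg E f -> forall z, E z ->
  P f (z + u)%R = excess u f z + P (fun y => f (y + u)%R) z.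
Proof.
move=> Eu f0 z Ez.
have -> : P (fun y => f (y + u)%R) z =
    \esum_(y in E) (if y \in [set v + u | v in E]%R then
                      (p z (y - u))%:E * f y else 0).
  rewrite -esum_mkcondr setIidr; last exact: E_shift.
  rewrite esum_image; last by move=> x y _ _; exact: addIr.
  by apply: eq_esum => y Ey; rewrite addrK.
rewrite -esumD => [|y Ey|y Ey]; last 2 first.
- by rewrite mule_ge0 ?ladder_increment_ge0 ?f0.
- case: ifPn => // /set_mem[v Ev <-].
  by rewrite addrK mule_ge0 ?lee_fin ?hp.1 ?f0//; exact: E_D.
apply: eq_esum => y Ey.
have := ladder_increment_ge0 Eu Ez Ey; rewrite /incr /ladder_increment /pE.
case: ifPn => [/set_mem[v Ev yE]|_]; last by rewrite adde0.
move=> i0; rewrite -ge0_muleDl//; last by rewrite lee_fin -yE addrK hp.1.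
by rewrite -EFinD subrK.
Qed.

(** The term [i] collects the trajectories that follow the translated chain for
    [i] steps, use an excess transition at the next one, and are then free. *)
Lemma shift_expansion (f : nat -> lattice d -> \bar R) u : E u ->
  (forall n, nonneg E (f n)) ->
  (forall n x, E x -> f n.+1 x = P (f n) x) ->
  forall n z, E z ->
  f n (z + u)%R = iter n P (fun y => f 0%N (y + u)%R) z +
    \sum_(0 <= i < n) iter i P (excess u (f (n - i.+1)%N)) z.
Proof.
move=> Eu f0 fS; elim => [|n IH] z Ez.
  by rewrite big_nil adde0.
have excessf0 m : nonneg E (excess u (f m)).
  by apply: kop_ge0 => //; exact: ladder_increment_ge0.
have fsh0 m : nonneg E (fun y => f m (y + u)%R) by move=> y Ey; exact/f0/E_D.
rewrite fS; last exact: E_D.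
rewrite kop_shift//.
rewrite [P _ z](_ : _ = P (iter n P (fun y => f 0%N (y + u)%R) \+
    (fun z => \sum_(0 <= i < n) iter i P (excess u (f (n - i.+1)%N)) z)) z);
  last first.
  by apply: eq_kop => y Ey; exact: IH.
rewrite /P kopD//=; last 3 first.
- exact: pE_ge0.
- by apply: iter_kop_ge0 => //; exact: pE_ge0.
- move=> y Ey; apply: sume_ge0 => i _; apply: iter_kop_ge0 => //.
  exact: pE_ge0.
rewrite addeCA; congr (_ + _).
rewrite big_nat_recl// subn1/=; congr (_ + _).
rewrite kop_sum//; last by move=> i; apply: iter_kop_ge0 => //; exact: pE_ge0.
exact: pE_ge0.
Qed.

Variable G : lattice d -> lattice d -> \bar R.
Hypothesis GE : forall z, E z -> G 0%R z = \sum_(n <oo) kpow E pE n 0%R z.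

Let L := ladder_kernel E p G.
Let V := potential E L.
Let surv := mass E pE.
(** The mean of the exit time [tau], and the mean of its truncation [min tau n]. *)
Let mtau := potential E pE.
Let mtaun := partial_potential E pE.

(** The ladder operator when the Green function is cut to the first [n] steps from
    the origin: the sums of [shift_expansion] have this form. *)
Let trunc n f u := \sum_(0 <= i < n) iter i P (excess u f) 0%R.

Lemma G_ge0 z : E z -> 0 <= G 0%R z.
Proof.
move=> Ez; rewrite GE//; apply: nneseries_ge0 => n _ _.
by apply: kpow_ge0 => //; exact: pE_ge0.
Qed.

Lemma ladder_kernel_ge0 : nonneg_kernel E L.
Proof.
move=> x y Ex Ey; apply: esum_ge0 => z Ez.
by rewrite mule_ge0 ?G_ge0// ladder_increment_ge0.
Qed.

Lemma excess_ge0 u f : E u -> nonneg E f -> nonneg E (excess u f).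
Proof. by move=> Eu; exact/kop_ge0/ladder_increment_ge0. Qed.

Lemma iterP_excess_ge0 u f n :
  E u -> nonneg E f -> nonneg E (iter n P (excess u f)).
Proof. by move=> Eu f0; apply: iter_kop_ge0; [exact: pE_ge0|exact: excess_ge0]. Qed.

Lemma trunc_ge0 n f : nonneg E f -> nonneg E (trunc n f).
Proof. by move=> f0 u Eu; apply: sume_ge0 => i _; exact: iterP_excess_ge0. Qed.

Lemma le_trunc n m f g : (n <= m)%N -> nonneg E f ->
  (forall x, E x -> f x <= g x) ->
  forall u, E u -> trunc n f u <= trunc m g u.
Proof.
move=> nm f0 fg u Eu; apply: (@le_trans _ _ (trunc m f u)).
  apply: (@ereal_nondecreasing_series R
    (fun i => iter i P (excess u f) 0%R) xpredT) => //.
  by move=> i _ _; exact: iterP_excess_ge0.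
apply: lee_sum => i _; apply: le_iter_kop => //; first exact: pE_ge0.
by move=> x Ex; apply: le_kop => //; exact: ladder_increment_ge0.
Qed.

Lemma truncZ n c f : 0 <= c -> nonneg E f ->
  forall u, E u -> trunc n (fun y => c * f y) u = c * trunc n f u.
Proof.
move=> c0 f0 u Eu; rewrite /trunc ge0_sume_distrr; last first.
  by move=> i _; exact: iterP_excess_ge0.
apply: eq_bigr => i _; rewrite -iter_kopZ//.
- apply: eq_iter_kop => //; first exact: pE_ge0.
  by move=> x Ex; rewrite -kopZ//; exact: ladder_increment_ge0.
- exact: pE_ge0.
- exact: excess_ge0.
Qed.

(** Unfolding the Green function as the sum of the powers of [P] and exchanging the
    three sums. *)
Lemma kop_ladderE f u : E u -> nonneg E f ->
  kop E L f u = \sum_(n <oo) iter n P (excess u f) 0%R.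
Proof.
move=> Eu f0; have i0 := ladder_increment_ge0 Eu.
transitivity (\esum_(y in E) \esum_(z in E) (G 0%R z * (incr u z y * f y))).
  apply: eq_esum => y Ey; rewrite muleC -ge0_esumZl ?f0//; last first.
    by move=> z Ez; rewrite mule_ge0 ?G_ge0 ?i0.
  by apply: eq_esum => z Ez; rewrite muleC muleA.
rewrite esum_exchange => [|y z Ey Ez]; last first.
  by rewrite !mule_ge0 ?G_ge0 ?i0 ?f0.
transitivity (\esum_(z in E) \sum_(n <oo) (kpow E pE n 0%R z * excess u f z)).
  apply: eq_esum => z Ez; rewrite ge0_esumZl ?G_ge0//; last first.
    by move=> y Ey; rewrite mule_ge0 ?i0 ?f0.
  have kp0 n : 0 <= kpow E pE n 0%R z by apply: kpow_ge0 => //; exact: pE_ge0.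
  have Auf0 : 0 <= excess u f z by exact: excess_ge0.
  rewrite GE// nneseries_esumT// nneseries_esumT; last first.
    by move=> n; rewrite mule_ge0.
  rewrite muleC -ge0_esumZl//.
  by apply: eq_esum => n _; rewrite muleC.
transitivity (\esum_(z in E) \esum_(n in [set: nat])
    (kpow E pE n 0%R z * excess u f z)).
  apply: eq_esum => z Ez; rewrite nneseries_esumT// => n.
  by rewrite mule_ge0 ?excess_ge0//; apply: kpow_ge0 => //; exact: pE_ge0.
rewrite esum_exchange => [|z n Ez _]; last first.
  by rewrite mule_ge0 ?excess_ge0//; apply: kpow_ge0 => //; exact: pE_ge0.
rewrite nneseries_esumT => [|n]; last exact: iterP_excess_ge0.
apply: eq_esum => n _; rewrite -kop_kpow//; first exact: pE_ge0.
exact: excess_ge0.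
Qed.

Lemma trunc_le_kop n f u : E u -> nonneg E f -> trunc n f u <= kop E L f u.
Proof.
move=> Eu f0; rewrite kop_ladderE//; apply: nneseries_lim_ge => i _ _.
exact: iterP_excess_ge0.
Qed.

Lemma add_kop_ladder_le f u (a : nat -> \bar R) c b : E u -> nonneg E f ->
  0 <= c -> a @ \oo --> c ->
  (forall n, a n + trunc n f u <= b) -> c + kop E L f u <= b.
Proof.
move=> Eu f0 c0 ac ab; rewrite kop_ladderE//.
have cv : trunc n f u @[n --> \oo] --> \sum_(n <oo) iter n P (excess u f) 0%R.
  by apply: is_cvg_nneseries => i _ _; exact: iterP_excess_ge0.
apply: (cvge_le _ (cvgeD _ ac cv)); first by apply: nearW => n; exact: ab.
apply: ge0_adde_def; rewrite inE//; apply: nneseries_ge0 => n _ _.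
exact: iterP_excess_ge0.
Qed.

(** For a harmonic function that increases along translations, the part of
    [shift_expansion] carried by the common moves is at least [f 0]. *)
Lemma harmonic_ge_potential f : nonneg E f ->
  (forall x, E x -> P f x = f x) ->
  (forall z u, E z -> E u -> f z <= f (z + u)%R) ->
  forall x, E x -> f 0%R * V x <= f x.
Proof.
move=> f0 Pf fmono; apply: potential_le_supersolution => //.
- exact: ladder_kernel_ge0.
- exact: f0.
move=> u Eu; apply: (@add_kop_ladder_le _ _ (fun=> f 0%R)) => //.
- exact: f0.
- exact: cvg_cst.
move=> n; rewrite -[X in _ <= f X]add0r.
rewrite (@shift_expansion (fun=> f) u Eu (fun=> f0) _ n)//; last first.
  by move=> _ x Ex; rewrite Pf.
rewrite leeD2r//.
have iterP y : E y -> iter n P f y = f y.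
  elim: (n) y => //= m IH y Ey; rewrite -[RHS]Pf//; exact: eq_kop.
rewrite -[leLHS]iterP//.
apply: le_iter_kop => //; first exact: pE_ge0.
by move=> x Ex; exact: fmono.
Qed.

Lemma P1_le1 x : E x -> P (cst 1) x <= 1.
Proof.
move=> Ex; apply: le_trans (hp.2 x Ex).
by apply: le_esum => y Ey; rewrite mule1.
Qed.

Lemma surv_ge0 n : nonneg E (surv n).
Proof. by apply: mass_ge0; exact: pE_ge0. Qed.

Lemma surv_nonincreasing n m x : (n <= m)%N -> E x -> surv m x <= surv n x.
Proof.
move=> + Ex; elim: m => [|m IH]; first by rewrite leqn0 => /eqP ->.
rewrite leq_eqVlt => /predU1P[->//|]; rewrite ltnS => /IH; apply: le_trans.
rewrite /surv /mass iterSr; apply: le_iter_kop => //; first exact: pE_ge0.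
by move=> y Ey; exact: P1_le1.
Qed.

Lemma surv_le1 n x : E x -> surv n x <= 1.
Proof. by move=> Ex; exact: (@surv_nonincreasing 0%N). Qed.

Lemma surv_fin_num n x : E x -> surv n x \is a fin_num.
Proof.
move=> Ex; rewrite ge0_fin_numE ?surv_ge0//.
by rewrite (le_lt_trans (surv_le1 n Ex))// ltry.
Qed.

Lemma iterP_surv m n x : iter m P (surv n) x = surv (m + n) x.
Proof. by rewrite /surv /mass iterD. Qed.

(** All the survival probabilities met in [shift_expansion] are at times before [m],
    hence at least [surv m]. *)
Lemma surv_ge_trunc n m u : (n <= m)%N -> E u ->
  surv m 0%R + trunc n (surv m) u <= surv m u.
Proof.
move=> nm Eu; rewrite -[X in _ <= surv m X]add0r.
rewrite (shift_expansion Eu surv_ge0)//.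
rewrite [X in _ <= X + _](_ : _ = surv m 0%R)//.
rewrite leeD2l//; apply: (@le_trans _ _ (trunc m (surv m) u)).
  exact: le_trunc (surv_ge0 _) _ _ _.
rewrite /trunc; apply: lee_sum => i _.
apply: le_iter_kop => //; first exact: pE_ge0.
move=> x Ex; apply: le_kop => //; first exact: ladder_increment_ge0.
by move=> y Ey; apply: surv_nonincreasing => //; exact: leq_subr.
Qed.

Lemma mtaun_ge0 n : nonneg E (mtaun n).
Proof. by apply: partial_potential_ge0; exact: pE_ge0. Qed.

Lemma mtau_ge0 : nonneg E mtau.
Proof. by apply: potential_ge0; exact: pE_ge0. Qed.

Lemma mtaunS n x : E x -> mtaun n.+1 x = 1 + P (mtaun n) x.
Proof. by apply: partial_potentialS; exact: pE_ge0. Qed.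

Lemma mtauE x : E x -> mtau x = 1 + P mtau x.
Proof. by apply: potentialE; exact: pE_ge0. Qed.

Lemma mtaun_le_horizon n x : E x -> mtaun n x <= n%:R%:E.
Proof.
move=> Ex; rewrite /mtaun /partial_potential.
apply: (@le_trans _ _ (\sum_(0 <= i < n) 1)).
  by apply: lee_sum => i _; exact: surv_le1.
by rewrite sumEFin big_const_nat subn0 iter_addr addr0.
Qed.

Lemma le_mtaunS n x : E x -> mtaun n x <= mtaun n.+1 x.
Proof. by move=> Ex; apply: partial_potential_nd => //; exact: pE_ge0. Qed.

Lemma mtaun_shift_le n u z : E u -> E z ->
  mtaun n (z + u)%R <=
    mtaun n z + \sum_(0 <= i < n) iter i P (excess u (mtaun n)) z.
Proof.
move=> Eu.
(* the truncation level inside the excess is frozen at [n] for the induction *)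
suff {z}: forall m z, E z ->
    (m <= n)%N ->
    mtaun m (z + u)%R <=
      mtaun m z + \sum_(0 <= i < m) iter i P (excess u (mtaun n)) z.
  by move=> /(_ n z) + Ez; apply.
elim=> [|m IH] z Ez mn.
  by rewrite /mtaun !partial_potential0 big_nil adde0.
have excess0 i : nonneg E (iter i P (excess u (mtaun n))).
  by apply: iterP_excess_ge0 => //; exact: mtaun_ge0.
rewrite mtaunS; last exact: E_D.
rewrite kop_shift//; last exact: mtaun_ge0.
rewrite addeCA mtaunS// big_nat_recl// [leRHS]addeCA leeD//=.
  apply: le_kop => //; first exact: ladder_increment_ge0.
  move=> x Ex; apply: partial_potential_nd => //; first exact: pE_ge0.
  exact: ltnW.
rewrite -addeA leeD2l// -(@kop_sum _ _ _ _ pE_ge0)// -kopD//; last 3 first.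
- exact: pE_ge0.
- exact: mtaun_ge0.
- by move=> x Ex; apply: sume_ge0 => i _; exact: excess0.
apply: le_kop => //; first exact: pE_ge0.
by move=> x Ex; apply: IH => //; exact: ltnW.
Qed.

(** [mtaun n] is bounded by [n] and is a subsolution for the ladder kernel by
    [mtaun_shift_le], so the maximality of the potential applies. *)
Lemma mtaun_le_potential n u : E u -> mtaun n u <= mtaun n 0%R * V u.
Proof.
move=> Eu; have L0 := ladder_kernel_ge0.
have mean0fin : mtaun n 0%R \is a fin_num.
  rewrite ge0_fin_numE ?mtaun_ge0//.
  by rewrite (le_lt_trans (mtaun_le_horizon n E0))// ltry.
have [Voo|] := ltP (V u) +oo; last first.
  rewrite leye_eq => /eqP ->; case: n {mean0fin} => [|n].
    by rewrite /mtaun !partial_potential0 mul0e.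
  rewrite gt0_muley ?leey// mtaunS// (lt_le_trans lte01)// leeDl//.
  by apply: kop_ge0 => //; [exact: pE_ge0|exact: mtaun_ge0].
rewrite -(fineK mean0fin).
apply: (@subsolution_le_potential _ _ E L L0 _ n%:R) => //.
- move=> x Ex; rewrite fineK//; rewrite -[X in mtaun n X]add0r.
  apply: (le_trans (mtaun_shift_le _ Ex E0)).
  by rewrite leeD2l//; apply: trunc_le_kop => //; exact: mtaun_ge0.
- by rewrite fine_ge0// mtaun_ge0.
- by move=> x Ex; exact: mtaun_le_horizon.
Qed.

Lemma mtau_shift_ge n u z : E u -> E z ->
  mtaun n z + \sum_(0 <= i < n) iter i P (excess u mtau) z <= mtau (z + u)%R.
Proof.
move=> Eu; elim: n z => [|n IH] z Ez.
  by rewrite /mtaun partial_potential0 big_nil add0e mtau_ge0//; exact: E_D.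
have excess0 i : nonneg E (iter i P (excess u mtau)).
  by apply: iterP_excess_ge0 => //; exact: mtau_ge0.
rewrite mtauE; last exact: E_D.
rewrite kop_shift//; last exact: mtau_ge0.
rewrite [leRHS]addeCA mtaunS// big_nat_recl// [leLHS]addeCA leeD2l//=.
rewrite -addeA leeD2l// -(@kop_sum _ _ _ _ pE_ge0)// -kopD//; last 3 first.
- exact: pE_ge0.
- exact: mtaun_ge0.
- by move=> x Ex; apply: sume_ge0 => i _; exact: excess0.
by apply: le_kop => //; exact: pE_ge0.
Qed.

Lemma mtau_ge_potential u : E u -> mtau 0%R * V u <= mtau u.
Proof.
apply: potential_le_supersolution.
- exact: ladder_kernel_ge0.
- exact: mtau_ge0.
- move=> x Ex; apply: (@add_kop_ladder_le _ _ (mtaun^~ 0%R)) => //.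
  + exact: mtau_ge0.
  + exact: mtau_ge0.
  + by apply: cvg_partial_potential => //; exact: pE_ge0.
  + by move=> n; rewrite -[X in _ <= mtau X]add0r; exact: mtau_shift_ge.
- exact: mtau_ge0.
Qed.

(** The mean exit time dominates [mtau 0 * V], agrees with it at the origin, and
    loses one unit of time at each step; hence so does [V], up to scaling. *)
Lemma P_potential_lt1 : mtau 0%R < +oo -> P V 0%R < 1.
Proof.
move=> mtau_oo; rewrite ltNge; apply/negP => PV1.
have mean1 : 1 <= mtau 0%R.
  rewrite mtauE//.
  by rewrite leeDl//; apply: kop_ge0 => //; [exact: pE_ge0|exact: mtau_ge0].
have meanfin : mtau 0%R \is a fin_num by rewrite ge0_fin_numE ?mtau_ge0.
have : 1 + mtau 0%R <= mtau 0%R.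
  rewrite [leRHS]mtauE//.
  rewrite leeD2l//; apply: (@le_trans _ _ (mtau 0%R * P V 0%R)).
    by rewrite -[leLHS]mule1 lee_wpmul2l// mtau_ge0.
  rewrite -kopZ//; last 3 first.
  - exact: pE_ge0.
  - exact: mtau_ge0.
  - by apply: potential_ge0; exact: ladder_kernel_ge0.
  by apply: le_kop => //; [exact: pE_ge0|exact: mtau_ge_potential].
by rewrite -(fineK meanfin) -EFinD lee_fin gerDr ler10.
Qed.

Lemma mtaun_le_iterP n m x : E x -> mtaun n x <= m%:R%:E + iter m P (mtaun n) x.
Proof.
elim: m x => [|m IH] x Ex; first by rewrite add0e.
apply: le_trans (IH _ Ex) _; rewrite -natr1 EFinD -addeA leeD2l//.
apply: (@le_trans _ _ (iter m P (cst 1 \+ P (mtaun n)) x)).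
  apply: le_iter_kop => //; first exact: pE_ge0.
  by move=> y Ey; rewrite /= -mtaunS//; exact: le_mtaunS.
rewrite iter_kopD//; last 2 first.
- exact: pE_ge0.
- by apply: kop_ge0; [exact: pE_ge0|exact: mtaun_ge0].
by rewrite -iterSr/= leeD2r//; exact: surv_le1.
Qed.

(** The truncated mean times, which lose at most [m] in [m] steps, are bounded by
    [mtaun n 0 * V], and their value at the origin diverges. *)
Lemma iterP_potential_ge1 m : mtau 0%R = +oo -> 1 <= iter m P V 0%R.
Proof.
move=> mtau_oo; rewrite leNgt; apply/negP => q1.
have V0 : nonneg E V by apply: potential_ge0; exact: ladder_kernel_ge0.
have q0 : 0 <= iter m P V 0%R by apply: iter_kop_ge0 => //; exact: pE_ge0.
have qfin : iter m P V 0%R \is a fin_num.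
  by rewrite ge0_fin_numE// (lt_trans q1)// ltry.
set q := fine (iter m P V 0%R).
have q_lt1 : (q < 1)%R by rewrite -lte_fin fineK.
have bound n : mtaun n 0%R <= (m%:R / (1 - q))%:E.
  have meanfin : mtaun n 0%R \is a fin_num.
    by rewrite ge0_fin_numE ?mtaun_ge0// (le_lt_trans (mtaun_le_horizon n E0))// ltry.
  have : mtaun n 0%R <= m%:R%:E + mtaun n 0%R * iter m P V 0%R.
    apply: le_trans (mtaun_le_iterP n m E0) _; rewrite leeD2l//.
    rewrite -iter_kopZ//; last 2 first.
    - exact: pE_ge0.
    - exact: mtaun_ge0.
    by apply: le_iter_kop => //; [exact: pE_ge0|move=> x Ex; exact: mtaun_le_potential].
  rewrite -(fineK meanfin) -(fineK qfin) -EFinM -EFinD !lee_fin -/q.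
  by rewrite ler_pdivlMr ?subr_gt0// mulrBr mulr1 lerBlDr.
have : mtau 0%R <= (m%:R / (1 - q))%:E.
  have cv : mtaun^~ 0%R @ \oo --> mtau 0%R.
    by apply: cvg_partial_potential => //; exact: pE_ge0.
  by apply: (cvge_le _ cv); apply: nearW.
by rewrite mtau_oo leye_eq.
Qed.

Lemma surv_gt0 n : mtau 0%R = +oo -> 0 < surv n 0%R.
Proof.
move=> mtau_oo; rewrite lt0e surv_ge0// andbT; apply/eqP => s0.
have bound N : mtaun N 0%R <= n%:R%:E.
  apply: le_trans (mtaun_le_iterP N n E0) _; rewrite geeDl//.
  apply: (@le_trans _ _ (N%:R%:E * surv n 0%R)); last by rewrite s0 mule0.
  rewrite -iter_kopZ//; last exact: pE_ge0.
  apply: le_iter_kop => //; first exact: pE_ge0.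
  by move=> x Ex; rewrite mule1; exact: mtaun_le_horizon.
have : mtau 0%R <= n%:R%:E.
  have cv : mtaun^~ 0%R @ \oo --> mtau 0%R.
    by apply: cvg_partial_potential => //; exact: pE_ge0.
  by apply: (cvge_le _ cv); apply: nearW.
by rewrite mtau_oo leye_eq.
Qed.

(** Lower approximations of the renewal function that only see the first [n] steps
    of the chain: this horizon is what makes [surv_ge_Vn] hold without a limit. *)
Fixpoint Vn n u : \bar R := if n is m.+1 then 1 + trunc m (Vn m) u else 0.

Lemma Vn_ge0 n : nonneg E (Vn n).
Proof.
elim: n => [|n IH] u Eu //=; rewrite adde_ge0 ?lee01//; exact: trunc_ge0.
Qed.

Lemma Vn_nd u : E u -> nondecreasing_seq (Vn^~ u).
Proof.
move=> Eu; apply/nondecreasing_seqP => n; elim: n u Eu => [|n IH] u Eu.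
  exact: Vn_ge0.
by rewrite /= leeD2l//; apply: le_trunc => //; exact: Vn_ge0.
Qed.

Lemma surv_ge_Vn n m u : (n <= m)%N -> E u ->
  surv m 0%R * Vn n u <= surv m u.
Proof.
elim: n u => [|n IH] u nm Eu; first by rewrite mule0 surv_ge0.
rewrite /= ge0_muleDr ?mule1 ?trunc_ge0//; last exact: Vn_ge0.
apply: le_trans (surv_ge_trunc (ltnW nm) Eu); rewrite leeD2l//.
rewrite -truncZ//; last 2 first.
- exact: surv_ge0.
- exact: Vn_ge0.
apply: le_trunc => //.
  by move=> y Ey; rewrite mule_ge0 ?Vn_ge0// surv_ge0.
by move=> y Ey; apply: IH => //; exact: ltnW.
Qed.

Lemma V_ge0 : nonneg E V.
Proof. by apply: potential_ge0; exact: ladder_kernel_ge0. Qed.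

Lemma Vn_le n u : E u -> Vn n u <= V u.
Proof.
have L0 := ladder_kernel_ge0.
elim: n u => [|n IH] u Eu /=; first exact: V_ge0.
rewrite /V potentialE// leeD2l//.
apply: le_trans (trunc_le_kop n Eu (Vn_ge0 n)) _.
exact: le_kop.
Qed.

Lemma cvg_trunc n (f : nat -> lattice d -> \bar R) g :
  (forall i, nonneg E (f i)) ->
  (forall x, E x -> nondecreasing_seq (f^~ x)) ->
  (forall x, E x -> f^~ x @ \oo --> g x) ->
  forall u, E u -> trunc n (f i) u @[i --> \oo] --> trunc n g u.
Proof.
move=> f0 fnd fg u Eu; apply: cvg_nnesum => j _.
  by apply: nearW => i; exact: iterP_excess_ge0.
apply: (@cvg_iter_kop _ _ E pE pE_ge0 j (fun i => excess u (f i))) => //.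
- by move=> i; exact: excess_ge0.
- move=> x Ex a b ab; apply: le_kop => //; first exact: ladder_increment_ge0.
  by move=> y Ey; exact: fnd.
- by move=> x Ex; apply: cvg_kop => //; exact: ladder_increment_ge0.
Qed.

(** The limit of [Vn] is a supersolution of [w = 1 + L w], which [V] minimises. *)
Lemma cvg_Vn u : E u -> Vn^~ u @ \oo --> V u.
Proof.
pose l x := ereal_sup (range (Vn^~ x)).
have vl x : E x -> Vn^~ x @ \oo --> l x.
  by move=> Ex; exact/ereal_nondecreasing_cvgn/Vn_nd.
have l0 : nonneg E l.
  by move=> x Ex; apply: ereal_sup_ubound; exists 0%N.
suff lV x : E x -> l x = V x by move=> Eu; rewrite -lV//; exact: vl.
move=> Ex; apply/eqP; rewrite eq_le; apply/andP; split.
  by apply: ge_ereal_sup => _ [n _ <-]; exact: Vn_le.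
rewrite -[leLHS]mul1e; apply: potential_le_supersolution => //.
  exact: ladder_kernel_ge0.
move=> y Ey; apply: (@add_kop_ladder_le _ _ (fun=> 1)) => //; first exact: cvg_cst.
move=> n.
have cv : 1 + trunc n (Vn m) y @[m --> \oo] --> 1 + trunc n l y.
  apply: cvgeD; last 2 first.
  - exact: cvg_cst.
  - by apply: cvg_trunc => //; [exact: Vn_ge0|exact: Vn_nd].
  by rewrite fin_num_adde_defr.
apply: (cvge_le _ cv); exists n => // m /= nm.
apply: (@le_trans _ _ (Vn m.+1 y)).
  by rewrite /= leeD2l//; apply: le_trunc => //; exact: Vn_ge0.
by apply: ereal_sup_ubound; exists m.+1.
Qed.

Hypothesis mtau_oo : mtau 0%R = +oo.

Lemma iterP_Vn_le1 m n : iter m P (Vn n) 0%R <= 1.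
Proof.
have s0 := surv_gt0 n mtau_oo.
rewrite -(@lee_pmul2l _ (surv n 0%R))//; last exact: surv_fin_num.
rewrite mule1 -iter_kopZ//; last 3 first.
- exact: pE_ge0.
- exact: surv_ge0.
- exact: Vn_ge0.
apply: (@le_trans _ _ (iter m P (surv n) 0%R)).
  apply: le_iter_kop => //; first exact: pE_ge0.
  by move=> y Ey; exact: surv_ge_Vn.
by rewrite iterP_surv; apply: surv_nonincreasing => //; exact: leq_addl.
Qed.

Lemma cvg_iterP_Vn m : iter m P (Vn n) 0%R @[n --> \oo] --> iter m P V 0%R.
Proof.
apply: (@cvg_iter_kop _ _ E pE pE_ge0 m Vn) => //.
- exact: Vn_ge0.
- exact: Vn_nd.
- exact: cvg_Vn.
Qed.

Lemma iterP_potential m : iter m P V 0%R = 1.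
Proof.
apply/eqP; rewrite eq_le iterP_potential_ge1// andbT.
have cv := @cvg_iterP_Vn m.
by apply: (cvge_le _ cv); apply: nearW => n; exact: iterP_Vn_le1.
Qed.

Lemma kpow_fin_num m x : E x -> kpow E pE m 0%R x \is a fin_num.
Proof.
move=> Ex; have k0 : nonneg_kernel E (kpow E pE m).
  by apply: kpow_ge0; exact: pE_ge0.
rewrite ge0_fin_numE; last exact: k0.
apply: (@le_lt_trans _ _ 1); last by rewrite ltry.
apply: le_trans (surv_le1 m E0).
rewrite /surv /mass -kop_kpow//; last exact: pE_ge0.
rewrite -[leLHS]mule1.
apply: (@esum_ge_term _ _ E (fun y => kpow E pE m 0%R y * 1)) => // y Ey.
by rewrite mule1; exact: k0.
Qed.

Hypothesis irr : forall x, E x -> exists m, 0 < kpow E pE m 0%R x.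

(** Irreducibility enters here: the origin sees [x] in some number of steps, and
    [P^m V] is finite at the origin. *)
Lemma potential_fin_num x : E x -> V x \is a fin_num.
Proof.
move=> Ex; have [m kx] := irr Ex.
rewrite ge0_fin_numE ?V_ge0// ltNge leye_eq; apply/negP => /eqP Voo.
have : kpow E pE m 0%R x * V x <= 1.
  rewrite -(iterP_potential m) -[leRHS]kop_kpow//; last 2 first.
  - exact: pE_ge0.
  - exact: V_ge0.
  apply: (@esum_ge_term _ _ E (fun y => kpow E pE m 0%R y * V y)) => // y Ey.
  by rewrite mule_ge0 ?V_ge0//; apply: kpow_ge0 => //; exact: pE_ge0.
by rewrite Voo gt0_muley// leye_eq.
Qed.

(** [f 0 * V <= f] and both sides have the same image under [P^m] at the origin, so
    there is no room for a gap at a point that the origin reaches. *)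
Lemma harmonic_eq_potential f : nonneg E f ->
  (forall x, E x -> P f x = f x) -> (forall x, E x -> f x \is a fin_num) ->
  (forall z u, E z -> E u -> f z <= f (z + u)%R) ->
  forall x, E x -> f x = f 0%R * V x.
Proof.
move=> f0 Pf ffin fmono x Ex; have [m kx] := irr Ex.
have fV := harmonic_ge_potential f0 Pf fmono.
apply/eqP; rewrite eq_le fV// andbT.
have fVfin : f 0%R * V x \is a fin_num.
  by rewrite fin_numM ?ffin ?potential_fin_num.
have := @iter_kop_gap _ _ E pE pE_ge0 m (fun y => f 0%R * V y) f 0%R x
  _ fV fVfin E0 Ex.
have iterP y : E y -> iter m P f y = f y.
  elim: (m) y => //= i IH y Ey; rewrite -[RHS]Pf//; exact: eq_kop.
rewrite iterP// iter_kopZ//; last 3 first.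
- exact: pE_ge0.
- exact: f0.
- exact: V_ge0.
rewrite iterP_potential mule1 => gap.
have {gap} : f 0%R + kpow E pE m 0%R x * (f x - f 0%R * V x) <= f 0%R.
  by apply: gap => y Ey; rewrite mule_ge0 ?V_ge0 ?f0.
rewrite -[leRHS]adde0 leeD2lE ?ffin//.
rewrite pmule_rle0// sube_le0// => _; exact: fVfin.
Qed.

(** The gap between [surv n 0 * Vn n] and [surv n] at [x], seen from the origin, is at
    most [surv n 0 * (1 - P^m (Vn n) 0)], and the last factor tends to [0]. *)
Lemma cvg_surv_ratio x : E x ->
  (fine (surv n x) / fine (surv n 0))%R @[n --> \oo] --> fine (V x).
Proof.
move=> Ex; have [m kx] := irr Ex.
set w := fine (kpow E pE m 0%R x).
have w0 : (0 < w)%R by rewrite fine_gt0// kx/= -ge0_fin_numE ?ltW// kpow_fin_num.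
have hfin n : Vn n x \is a fin_num.
  rewrite ge0_fin_numE ?Vn_ge0//.
  by rewrite (le_lt_trans (Vn_le n Ex))// -ge0_fin_numE ?V_ge0// potential_fin_num.
have qfin n : iter m P (Vn n) 0%R \is a fin_num.
  rewrite ge0_fin_numE.
    by rewrite (le_lt_trans (iterP_Vn_le1 m n))// ltry.
  by apply: iter_kop_ge0 => //; [exact: pE_ge0|exact: Vn_ge0].
pose v n := fine (Vn n x); pose q n := fine (iter m P (Vn n) 0%R).
have cv : v n @[n --> \oo] --> fine (V x).
  apply: fine_cvg; rewrite fineK ?potential_fin_num//; exact: cvg_Vn.
have cq : q n @[n --> \oo] --> (1 : R)%R.
  by apply: fine_cvg; rewrite -(iterP_potential m); exact: cvg_iterP_Vn.
apply: (@squeeze_cvgr _ _ _ _ v (fun n => v n + (1 - q n) / w)%R) => //; last first.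
  rewrite -[X in _ --> X]addr0; apply: cvgD => //.
  rewrite -[X in _ --> X](mul0r (w^-1)%R) -[X in (X * _)%R](subrr 1%R).
  by apply: cvgMl; apply: cvgB => //; exact: cvg_cst.
apply: nearW => n.
have s0 : (0 < fine (surv n 0))%R.
  by rewrite fine_gt0// surv_gt0//= -ge0_fin_numE ?surv_ge0// surv_fin_num.
have s0E := fineK (surv_fin_num n E0); have sxE := fineK (surv_fin_num n Ex).
have vs := surv_ge_Vn (leqnn n) Ex.
apply/andP; split.
  rewrite ler_pdivlMr// -lee_fin EFinM s0E sxE /v fineK//.
  by rewrite muleC.
have gap := @iter_kop_gap _ _ E pE pE_ge0 m (fun y => surv n 0%R * Vn n y)
  (surv n) 0%R x _ (fun y => @surv_ge_Vn n n y (leqnn n)) _ E0 Ex.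
have {gap} : surv n 0%R * iter m P (Vn n) 0%R +
    kpow E pE m 0%R x * (surv n x - surv n 0%R * Vn n x) <= surv n 0%R.
  rewrite -iter_kopZ//; last 3 first.
  - exact: pE_ge0.
  - exact: surv_ge0.
  - exact: Vn_ge0.
  apply: le_trans (gap _ _) _.
  - by move=> y Ey; rewrite mule_ge0 ?Vn_ge0// surv_ge0.
  - by rewrite fin_numM// surv_fin_num.
  - by rewrite iterP_surv; apply: surv_nonincreasing => //; exact: leq_addl.
rewrite -s0E -sxE -(fineK (qfin n)) -(fineK (hfin n)) -(fineK (kpow_fin_num m Ex)).
rewrite -!EFinM -EFinD lee_fin /= -/w -/(q n) -/(v n) => gap.
rewrite ler_pdivrMr// mulrDl -lerBlDl mulrAC ler_pdivlMr//.
by move: gap; lra.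
Qed.

End ladder.

Theorem theorem3 (R : realType) (d : nat) (E : set (lattice d))
  (p : lattice d -> lattice d -> R) (hp : substochastic E p)
  (* the chain Z and its laws P x *)
  (dO : measure_display) (Omega : measurableType dO)
  (P : lattice d -> probability Omega R)
  (Z : nat -> Omega -> option (lattice d))
  (hZ : absorbed_chain E (fun x y => (p x y)%:E) P Z)
  (hZtrans : transient_on E P Z)
  (* the ladder height chain H and its laws Q x *)
  (dO' : measure_display) (Omega' : measurableType dO')
  (Q : lattice d -> probability Omega' R)
  (H : nat -> Omega' -> option (lattice d))
  (hH : absorbed_chain E (ladder_kernel E p (green P Z)) Q H)
  (A1 : irreducible_on E P Z)
  (A3_0 : E 0)
  (A3_sub : forall u, E u -> [set x + u | x in E] `<=` E)
  (A3_p : forall u x y, E u -> E x -> E y -> p x y <= p (x + u) (y + u))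
  (h : lattice d -> R)
  (h_ge0 : forall x, E x -> 0 <= h x)
  (h_harm : harmonic_on E p h)
  (h_mono : forall z u, E z -> E u -> h z <= h (z + u)) :
  let V := renewal_function Q H in
  ((forall x, E x -> mean_exit_time (P x) Z = +oo%E) ->
    (exists c : R, forall x, E x -> (h x)%:E = (c%:E * V x)%E) /\
    forall x, E x ->
      let ratio n := fine (survival (P x) Z n) / fine (survival (P 0) Z n) in
      [/\ (h x)%:E = ((h 0)%:E * V x)%E,
          cvgn ratio &
          h x = h 0 * limn ratio])
  /\
  ((forall x, E x -> (mean_exit_time (P x) Z < +oo)%E) ->
    (exists2 x, E x & h x != 0) ->
    (forall x, E x -> ((h 0)%:E * V x <= (h x)%:E)%E) /\
    exists2 x, E x & ((h x)%:E - (h 0)%:E * V x)%E != 0%E).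
Proof.
set pE := fun x y => (p x y)%:E; pose P0 := pE_ge0 hp.
have GE z : E z -> green P Z 0 z = (\sum_(n <oo) kpow E pE n 0%R z)%E.
  move=> Ez; apply: eq_eseriesr => n _.
  exact: (markov_law P0 (hZ 0 A3_0) n Ez).
have L0 := ladder_kernel_ge0 hp A3_0 A3_sub A3_p GE.
set L := ladder_kernel E p (green P Z) in hH L0.
have VE x : E x -> renewal_function Q H x = potential E L x.
  by move=> Ex; exact: (mean_exit_timeE L0 Ex (hH x Ex)).
have SE x : E x -> mean_exit_time (P x) Z = potential E pE x.
  by move=> Ex; exact: (mean_exit_timeE P0 Ex (hZ x Ex)).
have irr x : E x -> exists m, (0 < kpow E pE m 0%R x)%E.
  move=> Ex; have [m Pm] := A1 0 x A3_0 Ex.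
  by exists m; rewrite -(markov_law P0 (hZ 0 A3_0)).
pose hE x := (h x)%:E.
have hE0 : nonneg E hE by move=> x Ex; rewrite lee_fin h_ge0.
have hE_harm x : E x -> kop E pE hE x = hE x.
  by move=> Ex; rewrite -[RHS]h_harm//; apply: eq_esum => y Ey; rewrite EFinM.
have hE_mono z u : E z -> E u -> (hE z <= hE (z + u)%R)%E.
  by move=> Ez Eu; rewrite lee_fin h_mono.
split=> [Soo|Sfin hn0].
  have {}Soo : potential E pE 0 = +oo%E by rewrite -SE// Soo.
  have hV x : E x -> (h x)%:E = ((h 0)%:E * renewal_function Q H x)%E.
    move=> Ex; rewrite VE//.
    exact: (harmonic_eq_potential hp A3_0 A3_sub A3_p GE Soo irr hE0 hE_harm).
  split; first by exists (h 0).
  move=> x Ex ratio.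
  have ratio_cvg : ratio @ \oo --> fine (potential E L x).
    rewrite (_ : ratio = fun n =>
        fine (mass E pE n x) / fine (mass E pE n 0)); last first.
      apply/funext => n; rewrite /ratio.
      by rewrite (survivalE P0 Ex (hZ x Ex)) (survivalE P0 A3_0 (hZ 0 A3_0)).
    exact: (cvg_surv_ratio hp A3_0 A3_sub A3_p GE Soo irr Ex).
  split; [exact: hV|exact: cvgP ratio_cvg|].
  rewrite (cvg_lim _ ratio_cvg)//; apply: EFin_inj.
  rewrite hV// VE// EFinM fineK//.
  exact: (potential_fin_num hp A3_0 A3_sub A3_p GE Soo irr Ex).
have hV x : E x -> ((h 0)%:E * renewal_function Q H x <= (h x)%:E)%E.
  move=> Ex; rewrite VE//.
  exact: (harmonic_ge_potential hp A3_0 A3_sub A3_p GE hE0 hE_harm).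
split; first exact: hV.
apply: contrapT => trivial_diff.
have hVE x : E x -> (h x)%:E = ((h 0)%:E * potential E L x)%E.
  move=> Ex; rewrite -VE//.
  have : ((h x)%:E - (h 0)%:E * renewal_function Q H x = 0)%E.
    by apply: contrapT => /eqP diff; apply: trivial_diff; exists x.
  by case: ((h 0)%:E * _)%E => // r /eqP; rewrite -EFinB eqe subr_eq0 => /eqP ->.
have h0 : 0 < h 0.
  rewrite lt_neqAle h_ge0// andbT eq_sym; apply/eqP => h0.
  have [x Ex /eqP] := hn0; apply; apply: EFin_inj.
  by rewrite hVE// h0 mul0e.
have PV1 : (kop E pE (potential E L) 0%R < 1)%E.
  by apply: (P_potential_lt1 hp A3_0 A3_sub A3_p GE); rewrite -SE// Sfin.
have : (hE 0%R < hE 0%R)%E.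
  rewrite -{1}hE_harm//.
  rewrite (@eq_kop _ _ E pE hE (fun y => (h 0)%:E * potential E L y)%E)//.
  rewrite kopZ; [|exact: P0|exact: ltW|exact: potential_ge0|exact: A3_0].
  by rewrite -[ltRHS]mule1 lte_pmul2l.
by rewrite ltxx.
Qed.
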